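(* Let $(X,E)$ be an expansive graph. Then the following assertions are equivalent: (i) $(X,E)$ is (Gromov) hyperbolic; (ii) there exists $L<\infty$ such that the lengths of all horizontal geodesics in $(X,E)$ are bounded by $L$; (iii) $(X,E)$ is $(m,k)$-departing for some positive integers $m$ and $k$.
   Context: A rooted graph $(X,E)$ is a countable vertex set $X$ with a symmetric edge set $E\subset X\times X\setminus\Delta$ ($\Delta$ the diagonal) that is locally finite and connected, with a fixed root $\vartheta\in X$. Let $d$ be the graph distance on $(X,E)$ and $|x|:=d(\vartheta,x)$. For an integer $m\ge 0$, $\mathcal J_m(x)$ is the set of $y\in X$ with $|y|=|x|+m$ such that $x$ lies on some geodesic from $\vartheta$ to $y$. The horizontal edge set is $E_h=\{(x,y)\in E:|x|=|y|\}$, and $d_h$ is the graph distance on $(X,E_h)$ ($d_h(x,y)=\infty$ if no path exists). A horizontal geodesic is a (finite) geodesic of $(X,E)$ all of whose edges are in $E_h$. $(X,E)$ is expansive if it is a rooted graph such that for $x,y\in X$: $d_h(x,y)>1$ implies $d_h(u,v)>1$ for all $u\in\mathcal J_1(x)$, $v\in\mathcal J_1(y)$. For positive integers $m,k$, a rooted graph is $(m,k)$-departing if for $x,y\in X$: $d_h(x,y)>k$ implies $d_h(u,v)>2k$ for all $u\in\mathcal J_m(x)$, $v\in\mathcal J_m(y)$. The Gromov product is $(x|y)=\frac12(|x|+|y|-d(x,y))$, and $(X,E)$ is hyperbolic if there is $\delta\ge0$ with $(x|y)\ge\min\{(x|z),(z|y)\}-\delta$ for all $x,y,z\in X$. *)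

(* Defs.v *)
From HB Require Import structures.
From mathcomp Require Import all_boot all_order all_algebra.
From mathcomp Require Import boolp classical_sets cardinality reals.

Set Implicit Arguments.
Unset Strict Implicit.
Unset Printing Implicit Defensive.

Import Order.TTheory GRing.Theory Num.Theory.

Record rootedGraph := RootedGraph {
  vertex :> countType;
  edge : rel vertex;
  root : vertex;
  edge_sym : symmetric edge;
  edge_irr : irreflexive edge;
  edge_locally_finite : forall x, finite_set [set y | edge x y]%classic;
  edge_connected : forall x y, exists p, path edge x p /\ last x p = y }.

Section Distance.
Variables (X : countType) (e : rel X).

(* The edges of a path [x :: p] number [size p]. *)
Definition path_length (x y : X) : pred nat := fun n =>
  `[< exists p, [/\ path e x p, last x p = y & size p = n] >].

(* [None] stands for an infinite distance. *)
Definition gdist (x y : X) : option nat :=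
  if pselect (exists n, path_length x y n) is left h
  then Some (ex_minn h) else None.

Definition geodesic (x : X) (p : seq X) : bool :=
  path e x p && (gdist x (last x p) == Some (size p)).

End Distance.

Definition dist_gt (d : option nat) (k : nat) : bool :=
  if d is Some n then k < n else true.

Section RootedGraph.
Variable G : rootedGraph.

(* The default value is never used, by [edge_connected]. *)
Definition dist (x y : G) : nat := odflt 0 (gdist (@edge G) x y).

Definition level (x : G) : nat := dist (root G) x.

Definition descendant (m : nat) (x y : G) : Prop :=
  level y = level x + m /\
  exists p, [/\ geodesic (@edge G) (root G) p, last (root G) p = y
              & x \in root G :: p].

Definition hedge : rel G := fun x y => edge x y && (level x == level y).

Definition hdist (x y : G) : option nat := gdist hedge x y.

(* Geodesic for the whole graph, not merely for [hedge]. *)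
Definition hgeodesic (x : G) (p : seq G) : bool :=
  geodesic (@edge G) x p && path hedge x p.

Definition expansive : Prop :=
  forall x y : G, dist_gt (hdist x y) 1 ->
  forall u v : G, descendant 1 x u -> descendant 1 y v ->
  dist_gt (hdist u v) 1.

Definition departing (m k : nat) : Prop :=
  forall x y : G, dist_gt (hdist x y) k ->
  forall u v : G, descendant m x u -> descendant m y v ->
  dist_gt (hdist u v) (2 * k).

Local Open Scope ring_scope.
Variable R : realType.

Definition gromov_product (x y : G) : R :=
  ((level x)%:R + (level y)%:R - (dist x y)%:R) / 2.

Definition hyperbolic : Prop :=
  exists2 delta : R, 0 <= delta &
  forall x y z : G,
    gromov_product x y >=
      Num.min (gromov_product x z) (gromov_product z y) - delta.

End RootedGraph.

(* Main.v *)
Require Import Defs.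
From mathcomp Require Import all_boot all_order all_algebra.
From mathcomp Require Import boolp reals.
From mathcomp Require Import zify lra.

Set Implicit Arguments.
Unset Strict Implicit.
Unset Printing Implicit Defensive.

Import Order.TTheory GRing.Theory Num.Theory.

(** In an expansive graph, horizontal closeness [d_h <= k] with [k >= 1] passes
    from vertices to their ancestors.  Hence every walk can be replaced by one
    that is not longer and first climbs towards the root, then moves
    horizontally, then descends; its horizontal part is a geodesic when the walk
    is one.  So if the top of such a geodesic between [x] and [y] lies at level
    [l] and has length [h], then [(x|y) = l - h/2].  When horizontal geodesics
    have length at most [L], [(x|y)] is thus, up to a bounded error, the deepest
    level at which the ancestors of [x] and [y] are horizontally close, which
    gives hyperbolicity; and vertices at horizontal distance at most [2k] have
    close ancestors after [k] steps up, which gives the departing property.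
    Conversely, the midpoint of a horizontal geodesic of length [n] forces
    [delta >= (n - 1)/4], and if the graph is [(m,k)]-departing, climbing [m]
    levels halves horizontal distances, so a horizontal geodesic longer
    than [4m + 2k] could be shortened. *)

(** * Walks of prescribed length and the graph distance *)

Definition walk (X : Type) (e : rel X) (n : nat) (x y : X) : Prop :=
  exists p, [/\ path e x p, last x p = y & size p = n].

Section Walks.
Variables (X : countType) (e : rel X).
Implicit Types (x y z : X) (n k : nat).

Lemma walk0 x : walk e 0 x x.
Proof. by exists [::]. Qed.

Lemma walk0_eq {x y} : walk e 0 x y -> x = y.
Proof. by case=> -[|z p] []. Qed.

Lemma walk1 x y : e x y -> walk e 1 x y.
Proof. by move=> exy; exists [:: y]; rewrite /= exy. Qed.

Lemma walk_cat {m n x y z} : walk e m x y -> walk e n y z -> walk e (m + n) x z.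
Proof.
case=> p [ep <- <-] [q [eq <- <-]]; exists (p ++ q).
by rewrite cat_path ep eq last_cat size_cat.
Qed.

Lemma walk_split m n x z :
  walk e (m + n) x z -> exists2 y, walk e m x y & walk e n y z.
Proof.
case=> p [ep lp sp]; exists (last x (take m p)).
  exists (take m p); split=> //; last by rewrite size_takel // sp leq_addr.
  by move: ep; rewrite -{1}(cat_take_drop m p) cat_path => /andP[].
exists (drop m p); split; last by rewrite size_drop sp addKn.
  by move: ep; rewrite -{1}(cat_take_drop m p) cat_path => /andP[].
by rewrite -last_cat cat_take_drop.
Qed.

Lemma walkS {n x z} : walk e n.+1 x z -> exists2 y, e x y & walk e n y z.
Proof.
case=> -[[]|y p] //= [/andP[exy ep] lp [sp]].
by exists y => //; exists p.
Qed.

Lemma walk_sym n x y : symmetric e -> walk e n x y -> walk e n y x.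
Proof.
move=> es; elim: n x y => [|n IHn] x y.
  by move/walk0_eq->; exact: walk0.
case/walkS=> z exz /IHn yz; rewrite -addn1.
by apply: walk_cat yz _; apply: walk1; rewrite es.
Qed.

Lemma gdist_Some x y n :
  gdist e x y = Some n <->
  walk e n x y /\ (forall k, walk e k x y -> n <= k).
Proof.
rewrite /gdist; case: pselect => [h|h].
  case: ex_minnP => m /asboolP wm mmin; split.
    by case=> <-; split=> // k wk; apply: mmin; apply/asboolP.
  case=> wn nmin; congr Some; apply/eqP; rewrite eqn_leq nmin // andbT.
  by apply: mmin; apply/asboolP.
split=> // -[wn _]; case: h; exists n; exact/asboolP.
Qed.

Lemma dist_gtPn x y k :
  ~~ dist_gt (gdist e x y) k <-> exists2 n, n <= k & walk e n x y.
Proof.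
case d: (gdist e x y) => [n|] /=.
  have [wn nmin] := (gdist_Some _ _ _).1 d; rewrite -leqNgt.
  split=> [nk|[m mk /nmin nm]]; first by exists n.
  exact: leq_trans mk.
split=> // -[n _ wn]; move: d; rewrite /gdist; case: pselect => // -[].
exists n; exact/asboolP.
Qed.

End Walks.

(** * Walks and levels in a rooted graph *)

Section Graph.
Variable G : rootedGraph.
Implicit Types (x y z a b u v w : G).

Local Notation o := (Defs.root G).
Local Notation walkE := (walk (@edge G)).
Local Notation walkH := (walk (@hedge G)).

Lemma hedge_sym : symmetric (@hedge G).
Proof. by move=> x y; rewrite /hedge edge_sym eq_sym. Qed.

Lemma walkH_E {n x y} : walkH n x y -> walkE n x y.
Proof.
case=> p [hp lp sp]; exists p; split=> //.
by apply: sub_path hp => u v /andP[].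
Qed.

Lemma walkH_level {n x y} : walkH n x y -> level x = level y.
Proof.
elim: n x => [|n IHn] x; first by move/walk0_eq->.
by case/walkS=> z /andP[_ /eqP->] /IHn.
Qed.

Lemma gdistE x y : gdist (@edge G) x y = Some (dist x y).
Proof.
rewrite /dist; case d: gdist => [//|].
have [p [ep lp]] := edge_connected x y.
have: exists2 n, n <= size p & walkE n x y by exists (size p) => //; exists p.
by move/dist_gtPn; rewrite d.
Qed.

Lemma dist_walk x y : walkE (dist x y) x y.
Proof. by have /gdist_Some[] := gdistE x y. Qed.

Lemma dist_min {n x y} : walkE n x y -> dist x y <= n.
Proof. by have /gdist_Some[_] := gdistE x y; apply. Qed.

Lemma level_walk {n x y} : walkE n x y -> level y <= level x + n.
Proof. by move=> w; apply: dist_min (walk_cat (dist_walk _ _) w). Qed.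

Lemma walkE_sym {n x y} : walkE n x y -> walkE n y x.
Proof. exact/walk_sym/edge_sym. Qed.

Lemma walkH_sym {n x y} : walkH n x y -> walkH n y x.
Proof. exact/walk_sym/hedge_sym. Qed.

Lemma hgeodesicE x p :
  hgeodesic x p = path (@hedge G) x p && (dist x (last x p) == size p).
Proof.
rewrite /hgeodesic /geodesic gdistE andbC -[Some _ == Some _]/(_ == _).
by case hp: path; rewrite //= (sub_path _ hp) // => u v /andP[].
Qed.

(** * Ancestors and descendants *)

Definition desc m x y : Prop := walkE m x y /\ level y = level x + m.

(** A root geodesic to [y] has at least [level x] edges before [x] and at least [level y - level x]
    after it; these sum to its length [level y], so both bounds are attained. *)
Lemma descendantE m x y : descendant m x y <-> desc m x y.
Proof.
split=> [[lxy [p [/andP[ep]]]]|[[q [eq lq sq]] lxy]].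
  rewrite gdistE => /eqP[sp] lp xp; split=> //.
  have : x = last o (take (index x (o :: p)) p).
    rewrite (last_nth o) size_takel; last by rewrite -ltnS index_mem.
    rewrite -[X in nth _ X _]/(take (index x (o :: p)).+1 (o :: p)).
    by rewrite nth_take // nth_index.
  move: (index _ _) => i xi.
  have [ep1 ep2] : path (@edge G) o (take i p) /\ path (@edge G) x (drop i p).
    by apply/andP; move: ep; rewrite -{1}(cat_take_drop i p) cat_path -xi.
  have lx : level x <= size (take i p) by apply: dist_min; exists (take i p).
  have w : walkE (size (drop i p)) x y.
    exists (drop i p); split=> //.
    by rewrite xi -last_cat cat_take_drop.
  have ly := level_walk w.
  have ly' : level y = size p by rewrite -sp lp.
  have : size p = size (take i p) + size (drop i p) by rewrite -size_cat cat_take_drop.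
  move=> sE; have -> : m = size (drop i p) by lia.
  by [].
split=> //; have [p [ep lp sp]] := dist_walk o x.
exists (p ++ q); split; last first.
- by rewrite -cat_cons mem_cat -lp mem_last.
- by rewrite last_cat lp.
rewrite /geodesic cat_path ep lp eq gdistE last_cat lp lq size_cat sp sq /=.
by apply/eqP; congr Some.
Qed.

Lemma desc0 x : desc 0 x x.
Proof. by split; [exact: walk0|rewrite addn0]. Qed.

Lemma desc0_eq {x y} : desc 0 x y -> x = y.
Proof. by case=> /walk0_eq. Qed.

Lemma desc_cat {m n x y z} : desc m x y -> desc n y z -> desc (m + n) x z.
Proof.
by case=> w1 l1 [w2 l2]; split; [exact: walk_cat w1 w2 | rewrite l2 l1 addnA].
Qed.

Lemma desc_split m n x z :
  desc (m + n) x z -> exists2 y, desc m x y & desc n y z.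
Proof.
case=> /walk_split[y w1 w2] l; exists y; split=> //;
  have := level_walk w1; have := level_walk w2; lia.
Qed.

Lemma ancestor_exists m x : m <= level x -> exists a, desc m a x.
Proof.
move=> mx; have: desc (level x - m + m) o x.
  rewrite subnK //; split; first exact: dist_walk.
  suff -> : level o = 0 by [].
  by apply/eqP; rewrite -leqn0; apply: dist_min; apply: walk0.
by case/desc_split=> a _; exists a.
Qed.
Arguments ancestor_exists : clear implicits.

Lemma level_edge x y : edge x y ->
  [\/ desc 1 x y, desc 1 y x | hedge x y].
Proof.
move=> exy; have w := walk1 exy; have w' := walkE_sym w.
have := level_walk w; have := level_walk w' => l1 l2.
have [lt|lt|eq] := ltngtP (level x) (level y).
- by apply: Or31; split=> //; lia.
- by apply: Or32; split=> //; lia.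
- by apply: Or33; rewrite /hedge exy eq eqxx.
Qed.

(** * Bounded horizontal distance, without infinite values *)

Definition near k x y : Prop := exists2 n, n <= k & walkH n x y.

Lemma near_walk n x y : walkH n x y -> near n x y.
Proof. by exists n. Qed.

Lemma near_refl x k : near k x x.
Proof. by exists 0 => //; exact: walk0. Qed.

Lemma near_trans {j k x y z} : near j x y -> near k y z -> near (j + k) x z.
Proof.
by case=> m mj xy [n nk yz]; exists (m + n); [exact: leq_add | exact: walk_cat xy yz].
Qed.

Lemma near_leq {j k x y} : j <= k -> near j x y -> near k x y.
Proof. by move=> jk [n nj w]; exists n => //; exact: leq_trans jk. Qed.

Lemma near_sym k x y : near k x y -> near k y x.
Proof. by case=> n nk /walkH_sym; exists n. Qed.

Lemma near_level {k x y} : near k x y -> level x = level y.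
Proof. by case=> n _ /walkH_level. Qed.

Lemma hdist_near k x y : ~~ dist_gt (hdist x y) k <-> near k x y.
Proof. exact: dist_gtPn. Qed.

Lemma dist_ancestors i j k a b x y :
  desc i a x -> desc j b y -> near k a b -> dist x y <= i + j + k.
Proof.
case=> wx _ [wy _] [n nk /walkH_E w].
have := dist_min (walk_cat (walkE_sym wx) (walk_cat w wy)); lia.
Qed.

Lemma departingP m k : departing G m k <->
  forall x y u v, desc m x u -> desc m y v -> near (2 * k) u v -> near k x y.
Proof.
split=> [H x y u v xu yv uv|H x y xy u v /descendantE xu /descendantE yv].
  apply/hdist_near/negP=> xy; move/hdist_near/negP: uv; apply.
  by apply: (H x y) => //; apply/descendantE.
apply: contraT => /hdist_near uv; move: xy; apply: contraLR => _.
exact/hdist_near/(H x y u v).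
Qed.

(** * Ancestors and geodesics in expansive graphs *)

Section Expansive.
Hypothesis hG : expansive G.

(** Each inner vertex of the horizontal walk gets a parent, and expansiveness makes consecutive
    parents equal or adjacent. The bound is [k.+1] because even a single vertex may have two
    distinct, adjacent parents. *)
Lemma near_parents k u v x y :
  near k.+1 u v -> desc 1 x u -> desc 1 y v -> near k.+1 x y.
Proof.
have base u' v' x' y' : near 1 u' v' -> desc 1 x' u' -> desc 1 y' v' -> near 1 x' y'.
  move=> uv xu yv; apply/hdist_near/negP=> xy.
  move/hdist_near/negP: uv; apply.
  by apply: (hG xy); apply/descendantE.
elim: k u x => [|k IHk] u x; first exact: base.
case=> -[|[|n]] nk w xu yv.
- by apply: near_leq (base _ _ _ _ _ xu yv) => //; move/walk0_eq: w => ->; apply: near_refl.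
- by apply: near_leq (base _ _ _ _ (near_walk w) xu yv).
case/walkS: w => t ut tv.
have [|z zt] := ancestor_exists 1 t.
  by case/andP: (ut) => _ /eqP<-; case: xu => _ ->; lia.
rewrite -[k.+2]add1n; apply: (@near_trans _ _ _ z).
  by apply: base xu zt; apply: near_walk; exact: walk1.
by apply: (IHk t) zt yv; exists n.+1.
Qed.

Lemma near_ancestors k m u v x y :
  near k.+1 u v -> desc m x u -> desc m y v -> near k.+1 x y.
Proof.
elim: m u v => [|m IHm] u v uv; first by move=> /desc0_eq-> /desc0_eq->.
rewrite -addn1 => /desc_split[u' xu' u'u] /desc_split[v' yv' v'v].
by apply: IHm xu' yv'; apply: near_parents uv u'u v'v.
Qed.

Lemma near_ancestors_same m u x y : desc m x u -> desc m y u -> near 1 x y.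
Proof. by apply: near_ancestors; apply: near_refl. Qed.

(* Climb, then move horizontally, then descend: prepending a step to such a
   walk costs at most one, by pushing the new step up to the top level. *)
Lemma walk_normal_form n x y : walkE n x y ->
  exists i j a b h,
    [/\ desc i a x, desc j b y, walkH h a b & i + j + h <= n].
Proof.
elim: n x => [|n IHn] x.
  move/walk0_eq->; exists 0, 0, y, y, 0; split=> //; try exact: desc0.
  exact: walk0.
case/walkS=> z /level_edge xz /IHn[i [j [a [b [h [az bY ab le]]]]]].
have lab := walkH_level ab.
case: xz => [xz|zx|xz].
- case: i => [|i] in le az *.
    have az' := desc0_eq az; subst a.
    case: h => [|h] in le ab *.
      have zb := walk0_eq ab; subst b.
      exists 0, (1 + j), x, x, 0; split; try lia.
      + exact: desc0.
      + exact: desc_cat bY.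
      + exact: walk0.
    (* The horizontal part from [z] to [b] is lifted to run from [x] to a parent [c] of [b]; only
       the descent grows, by one. *)
    have [|c cb] := ancestor_exists 1 b; first by case: xz => _; lia.
    have [h' h'h w] := near_parents (near_walk ab) xz cb.
    exists 0, (1 + j), x, c, h'; split=> //; try lia.
    + exact: desc0.
    + exact: desc_cat bY.
  (* Since [x] is a parent of [z], one climbing step is saved; it pays for joining [c] to [a], both
     ancestors of [z]. *)
  have [|c cx] := ancestor_exists i x.
    by case: (xz) (az) => _ + [_]; lia.
  have cz : desc i.+1 c z by rewrite -addn1; apply: desc_cat cx xz.
  have [h' h'1 w] := near_ancestors_same cz az.
  exists i, j, c, b, (h' + h); split=> //; try lia.
  exact: walk_cat ab.
- exists (i + 1), j, a, b, h; split=> //; try lia.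
  exact: desc_cat az zx.
(* The horizontal step is lifted to the top level, between the ancestors [c] of [x] and [a] of
   [z]. *)
- have [|c cx] := ancestor_exists i x.
    by case/andP: (xz) (az) => _ /eqP-> [_ ->]; lia.
  have [h' h'1 w] := near_ancestors (near_walk (walk1 xz)) cx az.
  exists i, j, c, b, (h' + h); split=> //; try lia.
  exact: walk_cat ab.
Qed.

(** For a shortest walk the normal form cannot be shorter, so its horizontal part realizes the
    distance in the whole graph. *)
Lemma geodesic_normal_form x y : exists i j a p,
  [/\ desc i a x, desc j (last a p) y, hgeodesic a p & i + j + size p = dist x y].
Proof.
have [i [j [a [b [h [ax bY ab le]]]]]] := walk_normal_form (dist_walk x y).
have := dist_min (walkH_E ab).
have := dist_min (walk_cat (walkE_sym ax.1) (walk_cat (dist_walk a b) bY.1)).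
case: ab => p [hp lp sp] dxy dab; exists i, j, a, p; split; rewrite ?lp //.
  by rewrite hgeodesicE hp lp; apply/eqP; lia.
by lia.
Qed.

(** * From bounded horizontal geodesics to the departing property and hyperbolicity *)

Section Bounded.
Variable L : nat.
Hypothesis hL : forall x (p : seq G), hgeodesic x p -> size p <= L.

(** Closeness is weakened to [L.+1] so that [near_ancestors] applies even when [L = 0]. *)
Lemma bounded_normal_form x y : exists i j a b h,
  [/\ desc i a x, desc j b y, near L.+1 a b, h <= L & i + j + h = dist x y].
Proof.
have [i [j [a [p [ax bY hp eq]]]]] := geodesic_normal_form x y.
have hl := hL hp; exists i, j, a, (last a p), (size p); split=> //.
by exists (size p); [lia | move/andP: hp => [_ hp]; exists p].
Qed.

(** The constant is [1 + L.+1 + 1]: from [x] to another ancestor of [u], across to an ancestor of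
    [v], and on to [y]. *)
Lemma bounded_departing : departing G L.+3 L.+3.
Proof.
apply/departingP=> x y u v xu yv uv.
have [i [j [a [b [h [au bv ab hl eq]]]]]] := bounded_normal_form u v.
have luv := near_level uv; have lab := near_level ab.
have duv := dist_ancestors (desc0 u) (desc0 v) uv.
have ij : i = j by case: (au) (bv) => _ + [_]; lia.
(* As [2 * i + h <= 2 * L.+3], the top of the geodesic is not above the level of [x] and [y]. *)
subst j; have im : i <= L.+3 by lia.
have xu' := xu; have yv' := yv; have [_ lau] := au; have [_ lbv] := bv.
have [_ lxu] := xu; have [_ lyv] := yv.
have [|a' aa] := ancestor_exists (L.+3 - i) a; first by lia.
have [|b' bb] := ancestor_exists (L.+3 - i) b; first by lia.
have := near_ancestors ab aa bb.
have := desc_cat aa au; have := desc_cat bb bv; rewrite subnK //.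
move=> /near_ancestors_same b'v /near_ancestors_same a'u a'b'.
have := near_trans (near_sym (a'u _ xu)) (near_trans a'b' (b'v _ yv)).
by apply: near_leq; lia.
Qed.

(** Free of subtraction, this says [(x|y) >= l - (2 * L + 3) / 2] and [l >= min((x|z), (z|y))]. Here
    [l] is the shallower of the top levels of the geodesics from [x] to [z] and from [z] to [y]. *)
Lemma bounded_shallow_level x y z : exists2 l,
  dist x y + 2 * l <= level x + level y + (2 * L + 3) &
  level x + level z <= dist x z + 2 * l \/
  level z + level y <= dist z y + 2 * l.
Proof.
have [i1 [j1 [a1 [c1 [h1 [xa1 zc1 ac1 _ eq1]]]]]] := bounded_normal_form x z.
have [i2 [j2 [c2 [b2 [h2 [zc2 yb2 cb2 _ eq2]]]]]] := bounded_normal_form z y.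
have lac := near_level ac1; have lcb := near_level cb2.
have [[[_ lx] [_ lz1]] [[_ lz2] [_ ly]]] := ((xa1, zc1), (zc2, yb2)).
exists (minn (level a1) (level b2)); last first.
  by case: (leqP (level a1) (level b2)) => _; [left|right]; lia.
set l := minn _ _; have [la lb] : l <= level a1 /\ l <= level b2 by lia.
have [|a aa] := ancestor_exists (level a1 - l) a1; first by lia.
have [|c cc1] := ancestor_exists (level a1 - l) c1; first by lia.
have [|c' cc2] := ancestor_exists (level b2 - l) c2; first by lia.
have [|b bb] := ancestor_exists (level b2 - l) b2; first by lia.
have ac := near_ancestors ac1 aa cc1.
have cb := near_ancestors cb2 cc2 bb.
(* Both are ancestors of [z] at level [l]. *)
have cc : near 1 c c'.
  apply: near_ancestors_same (desc_cat cc1 zc1) _.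
  rewrite (_ : _ - _ + j1 = level b2 - l + i2); last by lia.
  exact: desc_cat cc2 zc2.
have := dist_ancestors (desc_cat aa xa1) (desc_cat bb yb2)
  (near_trans ac (near_trans cc cb)).
lia.
Qed.

Lemma bounded_hyperbolic (R : realType) : hyperbolic G R.
Proof.
exists ((2 * L + 3)%:R / 2)%R; first by rewrite divr_ge0 ?ler0n.
move=> x y z; have [l dl lz] := bounded_shallow_level x y z.
rewrite /gromov_product lerBlDr ge_min.
move: dl; rewrite -(ler_nat R) => dl.
by case: lz => lz; apply/orP; [left|right]; move: lz;
  rewrite -(ler_nat R) => lz; lra.
Qed.

End Bounded.
End Expansive.

(** * Bounds on horizontal geodesics from the departing property and from hyperbolicity *)

Lemma hgeodesic_walk x p : hgeodesic x p ->
  walkH (size p) x (last x p) /\ dist x (last x p) = size p.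
Proof. by rewrite hgeodesicE => /andP[hp /eqP]; split=> //; exists p. Qed.

(** The walk is cut into at most [q.+1] pieces of length at most [2 * k]; the departing property
    bounds each by [k] after [m] steps up. *)
Lemma departing_halves m k q u v x y : departing G m k ->
  near (q.+1 * (2 * k)) u v -> desc m x u -> desc m y v -> near (q.+1 * k) x y.
Proof.
move/departingP=> hD; elim: q u x => [|q IHq] u x.
  by rewrite !mul1n => uv xu yv; apply: hD uv.
case=> n nk uv xu yv; have [le|lt] := leqP n (2 * k).
  apply: near_leq (hD _ _ _ _ xu yv _); first by rewrite mulSn leq_addr.
  by exists n.
move: uv; rewrite -(subnKC (ltnW lt)) => /walk_split[w uw wv].
have [|z zw] := ancestor_exists m w.
  by rewrite -(walkH_level uw); case: xu => _ ->; apply: leq_addl.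
rewrite mulSn; apply: near_trans (hD _ _ _ _ xu zw (near_walk uw)) _.
apply: IHq zw yv; exists (n - 2 * k) => //.
by rewrite leq_subLR -mulSn.
Qed.

(** A detour [m] levels up gives [n <= 2 * m + (n %/ (2 * k)).+1 * k <= 2 * m + n / 2 + k] for the
    length [n]. *)
Lemma departing_bounded m k : 0 < k -> departing G m k ->
  forall x (p : seq G), hgeodesic x p -> size p <= 4 * m + 2 * k.
Proof.
move=> k0 hD x p /hgeodesic_walk[]; set y := last x p; set n := size p => w dxy.
have lxy := walkH_level w.
have [lt|le] := ltnP (level x) m.
  (* Where [m] steps up are impossible, the detour through the root is shorter than [2 * m]. *)
  have := dist_min (walk_cat (walkE_sym (dist_walk o x)) (dist_walk o y)).
  rewrite dxy -!/(level _); lia.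
have [x' xx] := ancestor_exists m x le.
have [|y' yy] := ancestor_exists m y; first by rewrite -lxy.
have nk : near ((n %/ (2 * k)).+1 * (2 * k)) x y.
  by exists n => //; apply/ltnW/ltn_ceil; lia.
have := dist_ancestors xx yy (departing_halves hD nk xx yy).
have := leq_trunc_div n (2 * k); rewrite dxy; nia.
Qed.

(** With [z] the midpoint, [(x|y) = level x - n / 2], while [(x|z)] and [(z|y)] are at least
    [level x - (n + 1) / 4]; hence [n <= 4 * delta + 1]. *)
Lemma hyperbolic_bounded (R : realType) : hyperbolic G R ->
  exists L : nat, forall x (p : seq G), hgeodesic x p -> size p <= L.
Proof.
case=> delta d0 hyp; exists (Num.bound (4 * delta + 1)%R).
move=> x p /hgeodesic_walk[]; set y := last x p; set n := size p => w dxy.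
have lxy := walkH_level w.
have [z xz zy] : exists2 z, walkH n./2 x z & walkH (n - n./2) z y.
  by apply: walk_split; rewrite subnKC //; lia.
have := hyp x y z; have := dist_min (walkH_E xz); have := dist_min (walkH_E zy).
rewrite /gromov_product dxy lerBlDr ge_min -lxy -(walkH_level xz) => dzy dxz hmin.
have {}dzy : 2 * dist z y <= n + 1 by lia.
have {}dxz : 2 * dist x z <= n + 1 by lia.
rewrite -(ler_nat R) in dzy; rewrite -(ler_nat R) in dxz.
have b : (4 * delta + 1 < (Num.bound (4 * delta + 1))%:R)%R.
  by apply: archi_boundP; lra.
by rewrite -(ler_nat R); case/orP: hmin => hmin; lra.
Qed.

End Graph.

Theorem theorem1p1 (R : realType) (G : rootedGraph) (hG : expansive G) :
  (hyperbolic G R <->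
     exists L : nat, forall (x : G) (p : seq G), hgeodesic x p -> size p <= L) /\
  ((exists L : nat, forall (x : G) (p : seq G), hgeodesic x p -> size p <= L) <->
     exists m k : nat, [/\ 0 < m, 0 < k & departing G m k]).
Proof.
split; split.
- exact: hyperbolic_bounded.
- by case=> L hL; apply: bounded_hyperbolic hL R.
- by case=> L hL; exists L.+3, L.+3; split=> //; apply: bounded_departing hL.
- case=> m [k [_ k0 hD]]; exists (4 * m + 2 * k).
  exact: departing_bounded.
Qed.
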